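(* Let $C_n(x;q,r)$ be the deformed Chebyshev polynomials of the second kind and let $\widetilde C_n(x;q,r)=r^{n/2}C_n(r^{-1/2}x;q,r)$. Then, as Taylor expansions at $s=0$, $$\frac{1}{1-2xs+r^{-1}s^2}\;{}_3\phi_2\left(\begin{array}{c}q,\;x_1s,\;x_2s\\ qa_1s,\;qa_2s\end{array};q,q^2\right)=\sum_{n=0}^\infty C_n(x;q,r)\frac{s^n}{1-q^{n+2}}$$ and $$\frac{1}{1-2xs+s^2}\;{}_3\phi_2\left(\begin{array}{c}q,\;q\widetilde a_1s,\;q\widetilde a_2s\\ qx_1s,\;qx_2s\end{array};q,qr\right)=\sum_{n=0}^\infty\frac{(q^2;q)_n}{(qr;q)_{n+1}}\widetilde C_n(x;q,r)s^n=\sum_{n=0}^\infty\frac{(q^2;q)_n}{(qr;q)_{n+1}}C_n(r^{-1/2}x;q,r)(r^{1/2}s)^n.$$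
   Context: The deformed Chebyshev polynomials of the second kind are defined by $C_0(x;q,r)=1$, $C_1(x;q,r)=2x$ and $$C_{n+1}(x;q,r)=2x\,C_n(x;q,r)-\frac{r^{-1}-q^{n+1}}{1-q^{n+1}}C_{n-1}(x;q,r)\qquad(n\ge1).$$ Put $x_{1,2}=x\pm\sqrt{x^2-1}$, $a_{1,2}=x\pm\sqrt{x^2-r^{-1}}$, $\widetilde a_{1,2}=r^{-1}(x\pm\sqrt{x^2-r})$, so that $1-2xs+s^2=(1-x_1s)(1-x_2s)$, $1-2xs+r^{-1}s^2=(1-a_1s)(1-a_2s)$, $1-2r^{-1}xs+r^{-1}s^2=(1-\widetilde a_1s)(1-\widetilde a_2s)$. $(t;q)_k=\prod_{j=0}^{k-1}(1-tq^j)$ and $${}_3\phi_2\left(\begin{array}{c}\alpha,\beta,\gamma\\ \delta,\epsilon\end{array};q,z\right)=\sum_{k=0}^\infty\frac{(\alpha;q)_k(\beta;q)_k(\gamma;q)_k}{(\delta;q)_k(\epsilon;q)_k(q;q)_k}z^k.$$ In particular the first left-hand side is $\sum_{k\ge0}\frac{(x_1s;q)_k(x_2s;q)_k}{(a_1s;q)_{k+1}(a_2s;q)_{k+1}}q^{2k}$. Both left-hand sides are functions of $s$ analytic at $s=0$, where $q,r,x$ are complex numbers with $r\neq0$ and $0<|q|<1$, and for the second identity $|qr|<1$, so that the basic hypergeometric series converge for $s$ near $0$; the same choice of $r^{1/2}$ is used throughout. *)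

(* Defs.v *)
From Stdlib Require Import Reals.
From Coquelicot Require Import Coquelicot.

Open Scope C_scope.

(* [2 * x * C_n - (r^-1 - q^(n+1)) / (1 - q^(n+1)) * C_(n-1)] is C_(n+1);
   below, [m] is this n and [p] is n - 1. *)
Fixpoint chebC (n : nat) (x q r : C) : C :=
  match n with
  | O => 1
  | S m =>
      match m with
      | O => 2 * x
      | S p => 2 * x * chebC m x q r
               - (/ r - q ^ S m) / (1 - q ^ S m) * chebC p x q r
      end
  end.

(* [rh] is the chosen square root r^(1/2), so r^(n/2) is [rh ^ n]. *)
Definition chebCt (n : nat) (x q r rh : C) : C :=
  rh ^ n * chebC n (/ rh * x) q r.

Fixpoint qpoch (t q : C) (k : nat) : C :=
  match k with
  | O => 1
  | S j => qpoch t q j * (1 - t * q ^ j)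
  end.

(* The 3phi2 series is well defined (no vanishing denominator), converges,
   and has sum [l]. *)
Definition is_phi32 (al be ga de ep q z l : C) : Prop :=
  (forall k : nat, qpoch de q k * qpoch ep q k * qpoch q q k <> 0) /\
  is_pseries
    (fun k : nat => qpoch al q k * qpoch be q k * qpoch ga q k
                    / (qpoch de q k * qpoch ep q k * qpoch q q k)) z l.

(* Main.v *)
Require Import Defs.
From Stdlib Require Import Reals.
From Stdlib Require Import Lra Lia.
From Coquelicot Require Import Coquelicot.
Open Scope C_scope.

(** Both identities say that a power series F(s) = sum g_n s^n is the solution,
    analytic at 0, of a first order q-difference equation
<<
      A(s) F(s) = 1 + z B(s) F(q s),
      A(s) = (1 - al1 s)(1 - al2 s),   B(s) = (1 - be1 s)(1 - be2 s).
>>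
    Comparing coefficients, this equation is a three-term recurrence for g_n
    ([qdiff_coeffs]).  For g_n = C_n / (1 - q^(n+2)), al = a, be = x and z = q^2
    it reduces to the recurrence of the C_n ([chebC_qdiff_coeffs]); for
    g_n = (q^2; q)_n / (qr; q)_(n+1) Ct_n, al = x, be = q at and z = q r it
    reduces to the recurrence Ct_n inherits from C_n ([chebCt_qdiff_coeffs]).

    Conversely, put H = A F, so that H(s) = 1 + z B(s) / A(q s) H(q s).
    Iterating n + 1 times gives
<<
      H(s) = t_0 + ... + t_n + t_(n+1) H(q^(n+1) s),
      t_k = z^k B(s) B(q s) ... B(q^(k-1) s) / (A(q s) ... A(q^k s)),
>>
    and t_k is exactly the k-th term of the 3phi2 series, the factors (q; q)_k
    of its numerator and denominator cancelling.  Near s = 0 each ratio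
    z B(q^k s) / A(q^(k+1) s) is close to z, hence of modulus at most
    (1 + |z|) / 2 < 1 ([quadratic_ratio_bound]), while H is bounded; so the
    remainder tends to 0 and the 3phi2 series sums to H(s) = A(s) F(s).  This
    is [qdiff_solution_is_phi32].  That F does converge near 0 follows from the
    recurrence, whose coefficients are bounded ([qdiff_coeffs_bound]). *)

(** * Complex modulus and q-shifted factorials *)

Lemma Cmod_minus_le (u v : C) : (Cmod (u - v) <= Cmod u + Cmod v)%R.
Proof.
unfold Cminus; rewrite <- (Cmod_opp v); apply Cmod_triangle.
Qed.

Lemma Cmod_one_minus_ge (u : C) : (1 - Cmod u <= Cmod (1 - u))%R.
Proof.
assert (H := Cmod_triangle (1 - u) u).
replace (1 - u + u) with (RtoC 1) in H by ring.
rewrite Cmod_1 in H; lra.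
Qed.

Lemma one_minus_neq_0 (u : C) : (Cmod u < 1)%R -> 1 - u <> 0.
Proof.
intros Hu; apply Cmod_gt_0; assert (H := Cmod_one_minus_ge u); lra.
Qed.

Lemma Cmod_mult_pow_le (q c : C) (n : nat) :
  (Cmod q < 1)%R -> (Cmod (c * q ^ n) <= Cmod c)%R.
Proof.
intros Hq; rewrite Cmod_mult, Cmod_pow.
assert (0 <= Cmod c)%R by apply Cmod_ge_0.
assert (0 <= Cmod q)%R by apply Cmod_ge_0.
assert (H1 : (Cmod q ^ n <= 1 ^ n)%R) by (apply pow_incr; lra).
rewrite pow1 in H1; nra.
Qed.

Lemma one_minus_pow_neq_0 (q : C) (n : nat) :
  (Cmod q < 1)%R -> (0 < n)%nat -> 1 - q ^ n <> 0.
Proof.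
intros Hq Hn; apply one_minus_neq_0.
destruct n as [|n]; [lia|].
rewrite Cpow_S.
apply Rle_lt_trans with (2 := Hq); now apply Cmod_mult_pow_le.
Qed.

Lemma qpoch_neq_0 (t q : C) (k : nat) :
  (Cmod q < 1)%R -> (Cmod t < 1)%R -> qpoch t q k <> 0.
Proof.
intros Hq Ht; induction k as [|k IH]; simpl; [exact C1_nz|].
apply Cmult_neq_0; [exact IH|apply one_minus_neq_0].
apply Rle_lt_trans with (2 := Ht); now apply Cmod_mult_pow_le.
Qed.

(** The uniform structure on complex numbers is that of a product, whose balls
    are squares; this passes to discs. *)
Lemma locally_0_of_Cmod_lt (d : R) (P : C -> Prop) :
  (0 < d)%R -> (forall s : C, (Cmod s < d)%R -> P s) -> locally (0 : C) P.
Proof.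
intros Hd HP.
apply (locally_le_locally_norm (V := C_NormedModule)).
exists (mkposreal d Hd); intros s Hs; apply HP.
change (Cmod (s - 0) < d)%R in Hs.
rewrite <- (Cplus_0_r s).
replace (RtoC 0) with (- RtoC 0) by ring; exact Hs.
Qed.

Lemma pow_n_C (s : C) (n : nat) : @pow_n C_AbsRing s n = s ^ n.
Proof.
induction n as [|n IH]; [reflexivity|].
rewrite Cpow_S, <- IH; reflexivity.
Qed.

(** * Convergence of power series *)

(** The ratio [2 * M] works because [M + / 2 <= 2 * M]. *)
Lemma geometric_bound_of_recurrence (g : nat -> C) (M : R) :
  (1 <= M)%R ->
  (forall n, Cmod (g (S (S n))) <= M * Cmod (g (S n)) + M * Cmod (g n))%R ->
  exists K : R, forall n, (Cmod (g n) <= K * (2 * M) ^ n)%R.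
Proof.
intros HM Hg; exists (Cmod (g 0%nat) + Cmod (g 1%nat))%R.
set (K := (Cmod (g 0%nat) + Cmod (g 1%nat))%R).
assert (H0 := Cmod_ge_0 (g 0%nat)); assert (H1 := Cmod_ge_0 (g 1%nat)).
assert (H : forall n, (Cmod (g n) <= K * (2 * M) ^ n)%R /\
                      (Cmod (g (S n)) <= K * (2 * M) ^ S n)%R).
{ induction n as [|n [IH1 IH2]].
  - unfold K; simpl; split; nra.
  - split; [exact IH2|].
    apply Rle_trans with (1 := Hg n).
    assert (HP : (0 <= K * (2 * M) ^ n)%R)
      by (apply Rmult_le_pos; [unfold K; lra|apply pow_le; lra]).
    simpl in IH2 |- *.
    set (P := ((2 * M) ^ n)%R) in *.
    assert (HA : (M * Cmod (g (S n)) <= M * (K * (2 * M * P)))%R)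
      by (apply Rmult_le_compat_l; lra).
    assert (HB : (M * Cmod (g n) <= M * (K * P))%R)
      by (apply Rmult_le_compat_l; lra).
    assert (HC : (M * (K * P) <= M * (M * (K * P)))%R).
    { apply Rmult_le_compat_l; [lra|]. nra. }
    nra. }
intros n; apply H.
Qed.

(** The bound on the sum is uniform over the disc; it is what keeps the
    remainder of the iteration under control at all the points [q ^ n * s]. *)
Lemma pseries_sum_bound (g : nat -> C) (K M : R) (s : C) :
  (forall n, Cmod (g n) <= K * M ^ n)%R ->
  (0 <= M)%R -> (Cmod s * M <= / 2)%R ->
  exists l : C, is_pseries g s l /\ (Cmod l <= 2 * K)%R.
Proof.
intros Hg HM Hs.
assert (HK : (0 <= K)%R).
{ assert (H := Hg 0%nat); assert (H' := Cmod_ge_0 (g 0%nat)); simpl in H; lra. }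
set (a := fun n : nat => @scal C_AbsRing C_NormedModule (pow_n s n) (g n)).
assert (Ha : forall n, (@norm C_AbsRing C_NormedModule (a n) <= K * (/ 2) ^ n)%R).
{ intros n; change (Cmod (@pow_n C_AbsRing s n * g n) <= K * (/ 2) ^ n)%R.
  rewrite pow_n_C, Cmod_mult, Cmod_pow.
  assert (H1 : ((Cmod s * M) ^ n <= (/ 2) ^ n)%R).
  { apply pow_incr; split; [apply Rmult_le_pos; [apply Cmod_ge_0|exact HM]|exact Hs]. }
  rewrite Rpow_mult_distr in H1.
  assert (H2 : (0 <= Cmod s ^ n)%R) by apply pow_le, Cmod_ge_0.
  assert (H3 := Rmult_le_compat_l _ _ _ H2 (Hg n)).
  assert (H4 := Rmult_le_compat_l _ _ _ HK H1).
  lra. }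
assert (Hgeo : is_series (fun n : nat => (K * (/ 2) ^ n)%R) (2 * K)%R).
{ replace (2 * K)%R with (K * / (1 - / 2))%R by field.
  apply (is_series_scal_l (K := R_AbsRing) K (fun n : nat => ((/ 2) ^ n)%R)).
  apply is_series_geom; rewrite Rabs_pos_eq; lra. }
assert (Hex : ex_series (V := C_CompleteNormedModule) a).
{ apply (ex_series_le (V := C_CompleteNormedModule) a _ Ha).
  now exists (2 * K)%R. }
destruct Hex as [l Hl]; exists l; split; [exact Hl|].
change (Rbar_le (@norm C_AbsRing C_NormedModule l) (2 * K)%R).
apply is_lim_seq_le with
  (u := fun n => @norm C_AbsRing C_NormedModule (sum_n a n))
  (v := fun n => sum_n (fun k : nat => (K * (/ 2) ^ k)%R) n).
- intros n; eapply Rle_trans; [apply norm_sum_n_m|].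
  apply sum_n_m_le; exact Ha.
- apply (filterlim_comp _ _ _ (sum_n a) norm _ _ _ Hl (filterlim_norm l)).
- exact Hgeo.
Qed.

Lemma is_series_of_remainder (t : nat -> C) (l : C) (K rho : R) :
  (0 <= rho < 1)%R ->
  (forall n, Cmod (sum_n (G := C_AbelianMonoid) t n - l) <= K * rho ^ n)%R ->
  @is_series C_AbsRing C_NormedModule t l.
Proof.
intros Hrho Ht.
apply (filterlim_locally_ball_norm (U := C_NormedModule)).
intros eps.
assert (Hlim : is_lim_seq (fun n => K * rho ^ n)%R (K * 0)%R).
{ apply (is_lim_seq_scal_l _ K 0%R), is_lim_seq_geom; rewrite Rabs_pos_eq; lra. }
rewrite Rmult_0_r in Hlim.
apply is_lim_seq_spec in Hlim.
destruct (Hlim eps) as [N HN]; exists N; intros n Hn.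
change (Cmod (sum_n (G := C_AbelianMonoid) t n - l) < eps)%R.
apply Rle_lt_trans with (1 := Ht n).
assert (H := HN n Hn); apply Rabs_lt_between in H; lra.
Qed.

(** * The q-difference equation on coefficients *)

(** The coefficients of [s ^ 0], [s ^ 1] and [s ^ (n + 2)] in
    [(1 - al1 * s) * (1 - al2 * s) * F s
     = 1 + z * ((1 - be1 * s) * (1 - be2 * s)) * F (q * s)]
    for [F] the generating function of [g]. *)
Definition qdiff_coeffs (q z al1 al2 be1 be2 : C) (g : nat -> C) : Prop :=
  g 0%nat * (1 - z) = 1 /\
  g 1%nat * (1 - z * q) = g 0%nat * (al1 + al2 - z * (be1 + be2)) /\
  forall n : nat,
    g (S (S n)) * (1 - z * q ^ S (S n)) =
    g (S n) * (al1 + al2 - z * (be1 + be2) * q ^ S n)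
    - g n * (al1 * al2 - z * (be1 * be2) * q ^ n).

(** Since [|q| < 1] and [|z| < 1], the leading coefficients [1 - z * q ^ n] stay
    at distance at least [1 - |z|] from 0, so dividing by them leaves a
    recurrence with bounded coefficients. *)
Lemma qdiff_coeffs_bound (q z al1 al2 be1 be2 : C) (g : nat -> C) :
  (Cmod q < 1)%R -> (Cmod z < 1)%R ->
  qdiff_coeffs q z al1 al2 be1 be2 g ->
  exists K M : R, (1 <= M)%R /\ forall n, (Cmod (g n) <= K * M ^ n)%R.
Proof.
intros Hq Hz (_ & _ & Hg).
set (c := (1 - Cmod z)%R).
assert (Hc : (0 < c)%R) by (unfold c; lra).
set (T := (Cmod (al1 + al2) + Cmod (z * (be1 + be2))
           + Cmod (al1 * al2) + Cmod (z * (be1 * be2)))%R).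
assert (P1 := Cmod_ge_0 (al1 + al2)).
assert (P2 := Cmod_ge_0 (z * (be1 + be2))).
assert (P3 := Cmod_ge_0 (al1 * al2)).
assert (P4 := Cmod_ge_0 (z * (be1 * be2))).
assert (HT : (0 <= T / c)%R).
{ apply Rmult_le_pos; [unfold T; lra|apply Rlt_le, Rinv_0_lt_compat, Hc]. }
destruct (geometric_bound_of_recurrence g (1 + T / c)) as [K HK]; [lra| |].
2: { exists K, (2 * (1 + T / c))%R; split; [lra|exact HK]. }
intros n.
assert (E := f_equal Cmod (Hg n)); rewrite Cmod_mult in E.
assert (B0 : (c <= Cmod (1 - z * q ^ S (S n)))%R).
{ assert (H := Cmod_one_minus_ge (z * q ^ S (S n))).
  assert (H' := Cmod_mult_pow_le q z (S (S n)) Hq); unfold c; lra. }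
assert (B1 : (Cmod (al1 + al2 - z * (be1 + be2) * q ^ S n) <= T)%R).
{ eapply Rle_trans; [apply Cmod_minus_le|].
  assert (H := Cmod_mult_pow_le q (z * (be1 + be2)) (S n) Hq); unfold T; lra. }
assert (B2 : (Cmod (al1 * al2 - z * (be1 * be2) * q ^ n) <= T)%R).
{ eapply Rle_trans; [apply Cmod_minus_le|].
  assert (H := Cmod_mult_pow_le q (z * (be1 * be2)) n Hq); unfold T; lra. }
assert (E1 : (Cmod (g (S (S n))) * c
              <= T * Cmod (g (S n)) + T * Cmod (g n))%R).
{ apply Rle_trans with (Cmod (g (S (S n))) * Cmod (1 - z * q ^ S (S n)))%R.
  - apply Rmult_le_compat_l; [apply Cmod_ge_0|exact B0].
  - rewrite E; eapply Rle_trans; [apply Cmod_minus_le|].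
    rewrite !Cmod_mult.
    apply Rplus_le_compat; rewrite Rmult_comm;
      apply Rmult_le_compat_r; auto using Cmod_ge_0. }
assert (Q1 := Cmod_ge_0 (g (S n))); assert (Q2 := Cmod_ge_0 (g n)).
apply Rle_trans with (T / c * Cmod (g (S n)) + T / c * Cmod (g n))%R; [|lra].
apply Rmult_le_reg_r with (1 := Hc).
replace ((T / c * Cmod (g (S n)) + T / c * Cmod (g n)) * c)%R
  with (T * Cmod (g (S n)) + T * Cmod (g n))%R by (field; lra).
exact E1.
Qed.

Lemma pseries_mul_quadratic (g : nat -> C) (s F a b : C) :
  is_pseries g s F ->
  is_pseries
    (fun n => match n with
              | O => g 0%nat
              | 1%nat => g 1%nat - a * g 0%nat
              | S (S m as m1) => g n - a * g m1 + b * g m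
              end) s ((1 - a * s + b * s ^ 2) * F).
Proof.
intros HF.
assert (H1 := is_pseries_incr_1 _ _ _ HF).
assert (H2 := is_pseries_incr_1 _ _ _ H1).
assert (H1' := is_pseries_scal (- a) _ _ _ (Cmult_comm s (- a)) H1).
assert (H2' := is_pseries_scal b _ _ _ (Cmult_comm s b) H2).
assert (H := is_pseries_plus _ _ _ _ _ HF (is_pseries_plus _ _ _ _ _ H1' H2')).
replace ((1 - a * s + b * s ^ 2) * F) with
  (plus F (plus (scal (- a) (scal s F)) (scal b (scal s (scal s F))))).
- revert H; apply is_pseries_ext.
  intros [|[|n]]; unfold PS_plus, PS_scal, PS_incr_1, plus, scal, zero; simpl;
    unfold mult; simpl; ring.
- unfold plus, scal; simpl; unfold mult; simpl; ring.
Qed.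

Lemma is_pseries_dilate (g : nat -> C) (q s F : C) :
  is_pseries g (q * s) F -> is_pseries (fun n => q ^ n * g n) s F.
Proof.
apply is_series_ext; intros n.
change (@pow_n C_AbsRing (q * s) n * g n = @pow_n C_AbsRing s n * (q ^ n * g n)).
rewrite !pow_n_C, Cpow_mult_l.
now rewrite (Cmult_comm (q ^ n)), <- !Cmult_assoc.
Qed.

Lemma pseries_unit (s : C) :
  is_pseries (fun n => match n with O => RtoC 1 | S _ => RtoC 0 end) s (RtoC 1).
Proof.
apply is_series_of_remainder with (K := 0%R) (rho := 0%R); [lra|].
intros n.
replace (sum_n _ n) with (RtoC 1).
- replace (1 - 1) with (RtoC 0) by ring; rewrite Cmod_0; lra.
- induction n as [|n IH].
  + rewrite sum_O; change (RtoC 1 = 1 * 1); ring.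
  + rewrite sum_Sn, <- IH.
    change (RtoC 1 = 1 + @pow_n C_AbsRing s (S n) * 0); ring.
Qed.

(** Both sides are power series in [s]; [qdiff_coeffs] says that their
    coefficients agree. *)
Lemma pseries_qdiff (q z al1 al2 be1 be2 s F F' : C) (g : nat -> C) :
  qdiff_coeffs q z al1 al2 be1 be2 g ->
  is_pseries g s F -> is_pseries g (q * s) F' ->
  (1 - al1 * s) * (1 - al2 * s) * F
  = 1 + z * ((1 - be1 * s) * (1 - be2 * s)) * F'.
Proof.
intros (G0 & G1 & Gn) HF HF'.
assert (HA := pseries_mul_quadratic _ _ _ (al1 + al2) (al1 * al2) HF).
assert (HB := pseries_mul_quadratic _ _ _ (be1 + be2) (be1 * be2)
                (is_pseries_dilate _ _ _ _ HF')).
assert (HB' := is_pseries_scal z _ _ _ (Cmult_comm s z) HB).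
assert (HS := is_pseries_plus (V := C_NormedModule) _ _ _ _ _ (pseries_unit s) HB').
assert (E : (1 - (al1 + al2) * s + al1 * al2 * s ^ 2) * F
            = plus (RtoC 1) (scal z ((1 - (be1 + be2) * s + be1 * be2 * s ^ 2) * F'))).
{ refine (filterlim_locally_unique (V := C_NormedModule) (F := eventually) _ _ _ HA _).
  refine (is_pseries_ext (V := C_NormedModule) _ _ s _ _ HS).
  intros [|[|n]]; unfold PS_plus, PS_scal, plus, scal; simpl; unfold mult; simpl.
  - transitivity (g 0%nat * (1 - z) + z * g 0%nat); [rewrite G0|]; ring.
  - transitivity (g 1%nat - (g 1%nat * (1 - z * q))
                  - z * (be1 + be2) * g 0%nat); [ring|].
    rewrite G1; ring.
  - transitivity (g (S (S n)) - g (S (S n)) * (1 - z * q ^ S (S n))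
                  - z * (be1 + be2) * q ^ S n * g (S n)
                  + z * (be1 * be2) * q ^ n * g n); [simpl; ring|].
    rewrite Gn; simpl; ring. }
transitivity ((1 - (al1 + al2) * s + al1 * al2 * s ^ 2) * F); [ring|].
rewrite E; unfold plus, scal; simpl; unfold mult; simpl; ring.
Qed.

(** * Iterating the q-difference equation *)

(** For [e] small the quotient of the two quadratics is close to 1.  The
    threshold comes from [(1 + e) ^ 2 <= 1 + 3 * e] and
    [1 - 2 * e <= (1 - e) ^ 2]: with [|z| < 1], it is enough that
    [5 * e <= (1 + |z|) / 2 - |z|]. *)
Lemma quadratic_ratio_bound (z u1 u2 v1 v2 : C) (e : R) :
  (Cmod z < 1)%R -> (Cmod u1 <= e)%R -> (Cmod u2 <= e)%R ->
  (Cmod v1 <= e)%R -> (Cmod v2 <= e)%R -> (e <= (1 - Cmod z) / 10)%R ->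
  (Cmod (z * ((1 - v1) * (1 - v2)))
   <= (1 + Cmod z) / 2 * Cmod ((1 - u1) * (1 - u2)))%R.
Proof.
intros Hz Hu1 Hu2 Hv1 Hv2 He.
assert (Z0 := Cmod_ge_0 z); assert (E0 := Cmod_ge_0 u1).
assert (U1 := Cmod_one_minus_ge u1); assert (U2 := Cmod_one_minus_ge u2).
assert (V1 := Cmod_minus_le 1 v1); assert (V2 := Cmod_minus_le 1 v2).
rewrite Cmod_1 in V1, V2.
assert (W1 := Cmod_ge_0 (1 - v1)); assert (W2 := Cmod_ge_0 (1 - v2)).
rewrite !Cmod_mult.
assert (HV : (Cmod (1 - v1) * Cmod (1 - v2) <= (1 + e) * (1 + e))%R)
  by (apply Rmult_le_compat; lra).
assert (HU : ((1 - e) * (1 - e) <= Cmod (1 - u1) * Cmod (1 - u2))%R)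
  by (apply Rmult_le_compat; lra).
apply Rle_trans with (Cmod z * ((1 + e) * (1 + e)))%R.
- apply Rmult_le_compat_l; lra.
- apply Rle_trans with ((1 + Cmod z) / 2 * ((1 - e) * (1 - e)))%R.
  + assert (A1 : ((1 + e) * (1 + e) <= 1 + 3 * e)%R) by nra.
    assert (A2 : (1 - 2 * e <= (1 - e) * (1 - e))%R) by nra.
    assert (A3 := Rmult_le_compat_l _ _ _ Z0 A1).
    assert (A4 := Rmult_le_compat_l ((1 + Cmod z) / 2) _ _ ltac:(lra) A2).
    assert (A5 : (Cmod z * e <= e)%R) by nra.
    nra.
  + apply Rmult_le_compat_l; lra.
Qed.

(** The [k]-th term of the 3phi2 series after cancelling [qpoch q q k]. *)
Definition phi32_term (q z al1 al2 be1 be2 s : C) (k : nat) : C :=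
  z ^ k * (qpoch (be1 * s) q k * qpoch (be2 * s) q k
           / (qpoch (q * al1 * s) q k * qpoch (q * al2 * s) q k)).

(** The term ratio is the factor by which one more use of the q-difference
    equation multiplies the remainder; it is stated without division. *)
Lemma phi32_term_S (q z al1 al2 be1 be2 s : C) (k : nat) :
  (Cmod q < 1)%R ->
  (Cmod (q * al1 * s) < 1)%R -> (Cmod (q * al2 * s) < 1)%R ->
  phi32_term q z al1 al2 be1 be2 s (S k)
  * ((1 - al1 * (q ^ S k * s)) * (1 - al2 * (q ^ S k * s)))
  = phi32_term q z al1 al2 be1 be2 s k
    * (z * ((1 - be1 * (q ^ k * s)) * (1 - be2 * (q ^ k * s)))).
Proof.
intros Hq H1 H2; unfold phi32_term.
assert (D1 := qpoch_neq_0 _ _ (S k) Hq H1).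
assert (D2 := qpoch_neq_0 _ _ (S k) Hq H2).
simpl in D1, D2 |- *.
assert (N1 : qpoch (q * al1 * s) q k <> 0) by now apply qpoch_neq_0.
assert (N2 : qpoch (q * al2 * s) q k <> 0) by now apply qpoch_neq_0.
assert (M1 : 1 - q * al1 * s * q ^ k <> 0)
  by (intros E; apply D1; rewrite E; ring).
assert (M2 : 1 - q * al2 * s * q ^ k <> 0)
  by (intros E; apply D2; rewrite E; ring).
field; repeat split; assumption.
Qed.

(** A power series solution of the q-difference equation is summed by iterating
    the equation.  The disc is chosen so that its sum exists and is bounded
    there, the quadratics [A] do not vanish and the term ratios have modulus at
    most [rho < 1]; being stable under [s |-> q * s], it contains all the points
    [q ^ n * s] the iteration visits. *)
Theorem qdiff_solution_is_phi32 (q z al1 al2 be1 be2 : C) (g : nat -> C) :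
  (Cmod q < 1)%R -> (Cmod z < 1)%R ->
  qdiff_coeffs q z al1 al2 be1 be2 g ->
  locally (0 : C) (fun s : C =>
    exists phi : C,
      is_phi32 q (be1 * s) (be2 * s) (q * al1 * s) (q * al2 * s) q z phi /\
      is_pseries g s (1 / ((1 - al1 * s) * (1 - al2 * s)) * phi)).
Proof.
intros Hq Hz Hg.
destruct (qdiff_coeffs_bound _ _ _ _ _ _ _ Hq Hz Hg) as (K & M & HM & HgM).
(* [m] dominates all four roots, so [m * |s| <= e] makes every [c * q ^ n * s]
   with [c] a root of modulus at most [e]; [|s| <= / (2 * M)] gives the sums. *)
set (m := (1 + Cmod al1 + Cmod al2 + Cmod be1 + Cmod be2)%R).
assert (La1 := Cmod_ge_0 al1); assert (La2 := Cmod_ge_0 al2).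
assert (Lb1 := Cmod_ge_0 be1); assert (Lb2 := Cmod_ge_0 be2).
assert (Lz := Cmod_ge_0 z).
set (e := ((1 - Cmod z) / 10)%R).
assert (He : (0 < e <= / 10)%R) by (unfold e; lra).
assert (Hd1 : (0 < e / m)%R) by (apply Rdiv_lt_0_compat; unfold m; lra).
assert (Hd2 : (0 < / 2 / M)%R) by (apply Rdiv_lt_0_compat; lra).
apply locally_0_of_Cmod_lt with (1 := Rmin_pos _ _ Hd1 Hd2); intros s Hs.
assert (Ls := Cmod_ge_0 s).
assert (HsM : (Cmod s * M <= / 2)%R).
{ assert (H : (Cmod s <= / 2 / M)%R)
    by (apply Rlt_le, Rlt_le_trans with (1 := Hs), Rmin_r).
  apply Rmult_le_compat_r with (r := M) in H; [|lra].
  replace (/ 2 / M * M)%R with (/ 2)%R in H by (field; lra); exact H. }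
assert (Hsm : (m * Cmod s <= e)%R).
{ assert (H : (Cmod s <= e / m)%R)
    by (apply Rlt_le, Rlt_le_trans with (1 := Hs), Rmin_l).
  apply Rmult_le_compat_l with (r := m) in H; [|unfold m; lra].
  replace (m * (e / m))%R with e in H by (field; unfold m; lra); exact H. }
clear Hs Hd1 Hd2.
assert (Hroot : forall (c : C) (n : nat), (Cmod c <= m)%R ->
          (Cmod (c * (q ^ n * s)) <= e)%R).
{ intros c n Hc.
  replace (c * (q ^ n * s)) with (c * s * q ^ n) by ring.
  eapply Rle_trans; [now apply Cmod_mult_pow_le|].
  rewrite Cmod_mult; eapply Rle_trans; [|exact Hsm].
  now apply Rmult_le_compat_r. }
assert (Ha1 : (Cmod al1 <= m)%R) by (unfold m; lra).
assert (Ha2 : (Cmod al2 <= m)%R) by (unfold m; lra).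
assert (Hb1 : (Cmod be1 <= m)%R) by (unfold m; lra).
assert (Hb2 : (Cmod be2 <= m)%R) by (unfold m; lra).
assert (D1 : (Cmod (q * al1 * s) < 1)%R).
{ replace (q * al1 * s) with (al1 * (q ^ 1 * s)) by (simpl; ring).
  assert (H := Hroot al1 1%nat Ha1); lra. }
assert (D2 : (Cmod (q * al2 * s) < 1)%R).
{ replace (q * al2 * s) with (al2 * (q ^ 1 * s)) by (simpl; ring).
  assert (H := Hroot al2 1%nat Ha2); lra. }
set (A := fun n : nat => (1 - al1 * (q ^ n * s)) * (1 - al2 * (q ^ n * s))).
set (B := fun n : nat => (1 - be1 * (q ^ n * s)) * (1 - be2 * (q ^ n * s))).
set (t := phi32_term q z al1 al2 be1 be2 s).
assert (At : forall k, t (S k) * A (S k) = t k * (z * B k))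
  by (intros k; now apply phi32_term_S).
assert (An0 : forall n, A n <> 0).
{ intros n; apply Cmult_neq_0; apply one_minus_neq_0.
  - assert (H := Hroot al1 n Ha1); lra.
  - assert (H := Hroot al2 n Ha2); lra. }
assert (Abound : forall n, (Cmod (A n) <= 4)%R).
{ intros n; unfold A; rewrite Cmod_mult.
  assert (H1 := Cmod_minus_le 1 (al1 * (q ^ n * s))).
  assert (H2 := Cmod_minus_le 1 (al2 * (q ^ n * s))).
  rewrite Cmod_1 in H1, H2.
  assert (H3 := Hroot al1 n Ha1); assert (H4 := Hroot al2 n Ha2).
  replace 4%R with (2 * 2)%R by ring.
  apply Rmult_le_compat; try apply Cmod_ge_0; lra. }
set (rho := ((1 + Cmod z) / 2)%R).
assert (Hrho : (0 <= rho < 1)%R) by (unfold rho; lra).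
(* Term ratios have modulus at most [rho]. *)
assert (tbound : forall k, (Cmod (t k) <= rho ^ k)%R).
{ induction k as [|k IH].
  - unfold t, phi32_term; simpl.
    replace (1 * (1 * 1 / (1 * 1))) with (RtoC 1) by (field; exact C1_nz).
    rewrite Cmod_1; lra.
  - assert (HA : (0 < Cmod (A (S k)))%R) by apply Cmod_gt_0, An0.
    apply Rmult_le_reg_r with (1 := HA).
    rewrite <- Cmod_mult, At, Cmod_mult.
    assert (HR : (Cmod (z * B k) <= rho * Cmod (A (S k)))%R)
      by (apply quadratic_ratio_bound with (e := e); auto; unfold e; lra).
    simpl.
    replace (rho * rho ^ k * Cmod (A (S k)))%R
      with (rho ^ k * (rho * Cmod (A (S k))))%R by ring.
    apply Rmult_le_compat; auto using Cmod_ge_0. }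
assert (HF : forall n, exists F : C,
           is_pseries g (q ^ n * s) F /\ (Cmod F <= 2 * K)%R).
{ intros n; apply pseries_sum_bound with (M := M); [exact HgM|lra|].
  eapply Rle_trans; [|exact HsM].
  apply Rmult_le_compat_r; [lra|].
  rewrite Cmult_comm; now apply Cmod_mult_pow_le. }
destruct (HF 0%nat) as (F0 & HF0 & _).
(* The equation iterated [n + 1] times. *)
assert (Hrem : forall n, exists F : C,
          is_pseries g (q ^ S n * s) F /\ (Cmod F <= 2 * K)%R /\
          A 0%nat * F0 = sum_n (G := C_AbelianMonoid) t n + t (S n) * (A (S n) * F)).
{ assert (Hstep : forall n F F', is_pseries g (q ^ n * s) F ->
            is_pseries g (q ^ S n * s) F' -> A n * F = 1 + z * B n * F').
  { intros n F F' H H'; apply (pseries_qdiff q z al1 al2 be1 be2 _ _ _ g Hg H).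
    rewrite Cpow_S, <- Cmult_assoc in H'; exact H'. }
  induction n as [|n (F & HFn & _ & IH)].
  - destruct (HF 1%nat) as (F1 & HF1 & HK1); exists F1; repeat split; try assumption.
    rewrite (Hstep _ _ _ HF0 HF1), sum_O, Cmult_assoc, At.
    replace (t 0%nat) with (RtoC 1); [ring|].
    unfold t, phi32_term; simpl; field; exact C1_nz.
  - destruct (HF (S (S n))) as (F' & HF' & HK'); exists F'.
    repeat split; try assumption.
    rewrite IH, (Hstep _ _ _ HFn HF'), sum_Sn, !Cmult_assoc, At.
    change plus with Cplus; ring. }
assert (Hser : @is_series C_AbsRing C_NormedModule t (A 0%nat * F0)).
{ apply is_series_of_remainder with (K := (8 * K)%R) (rho := rho); [exact Hrho|].
  intros n; destruct (Hrem n) as (F & _ & HFK & E).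
  replace (sum_n (G := C_AbelianMonoid) t n - A 0%nat * F0)
    with (- (t (S n) * (A (S n) * F))) by (rewrite E; ring).
  rewrite Cmod_opp, !Cmod_mult.
  assert (X1 := tbound (S n)); assert (X2 := Abound (S n)).
  assert (X3 := Cmod_ge_0 F).
  assert (X4 : (Cmod (A (S n)) * Cmod F <= 4 * (2 * K))%R)
    by (apply Rmult_le_compat; auto using Cmod_ge_0).
  assert (X5 : (0 <= rho ^ n)%R) by (apply pow_le; lra).
  assert (X6 : (Cmod (t (S n)) <= rho ^ n)%R) by (simpl in X1; nra).
  rewrite Rmult_comm.
  replace (8 * K)%R with (4 * (2 * K))%R by ring.
  apply Rmult_le_compat; auto using Cmod_ge_0, Rmult_le_pos. }
assert (HA0 : A 0%nat = (1 - al1 * s) * (1 - al2 * s))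
  by (unfold A; simpl; ring).
exists (A 0%nat * F0); split.
- assert (Hqq : forall k, qpoch q q k <> 0) by (intros k; now apply qpoch_neq_0).
  assert (Hq1 : forall k, qpoch (q * al1 * s) q k <> 0)
    by (intros k; now apply qpoch_neq_0).
  assert (Hq2 : forall k, qpoch (q * al2 * s) q k <> 0)
    by (intros k; now apply qpoch_neq_0).
  split; [intros k; now repeat apply Cmult_neq_0|].
  revert Hser; apply is_series_ext; intros k.
  match goal with |- _ = scal _ ?b => change (t k = @pow_n C_AbsRing z k * b) end.
  rewrite pow_n_C; unfold t, phi32_term.
  field; repeat split; auto.
- replace (1 / ((1 - al1 * s) * (1 - al2 * s)) * (A 0%nat * F0)) with F0.
  + replace s with (q ^ 0 * s) by (simpl; ring); exact HF0.
  + rewrite <- HA0; field; apply An0.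
Qed.

(** * Deformed Chebyshev polynomials *)

(** Closes [b <> 0] from a hypothesis [a <> 0] with [a] and [b] equal in the
    ring; [field] returns its side conditions in expanded form. *)
Ltac nonzero_up_to_ring :=
  cbv beta;
  match goal with
  | H : ?a <> _ |- ?b <> _ =>
      let E := fresh in
      intros E; apply H; transitivity b; [ring|exact E]
  end.

Lemma chebC_SS (n : nat) (x q r : C) :
  chebC (S (S n)) x q r
  = 2 * x * chebC (S n) x q r
    - (/ r - q ^ S (S n)) / (1 - q ^ S (S n)) * chebC n x q r.
Proof. reflexivity. Qed.

(** Scaling by [rh ^ n] and evaluating at [/ rh * x] turns [/ r] and 1 in the
    recurrence into 1 and [r]; the square root itself disappears. *)
Lemma chebCt_SS (n : nat) (x q r rh : C) :
  r <> 0 -> (Cmod q < 1)%R -> rh ^ 2 = r ->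
  chebCt (S (S n)) x q r rh
  = 2 * x * chebCt (S n) x q r rh
    - (1 - r * q ^ S (S n)) / (1 - q ^ S (S n)) * chebCt n x q r rh.
Proof.
intros Hr Hq Hrh.
assert (Hrh0 : rh <> 0) by (intros E; apply Hr; rewrite <- Hrh, E; ring).
assert (N : 1 - q ^ S (S n) <> 0) by (apply one_minus_pow_neq_0; [exact Hq|lia]).
unfold chebCt; rewrite chebC_SS, !(Cpow_S rh).
replace (r * q ^ S (S n)) with (rh ^ 2 * q ^ S (S n)) by now rewrite Hrh.
replace (/ r) with (/ rh ^ 2) by now rewrite Hrh.
generalize (chebC (S n) (/ rh * x) q r), (chebC n (/ rh * x) q r).
intros c1 c0; revert N; generalize (q ^ S (S n)), (rh ^ n); intros Q R N.
field; split; assumption.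
Qed.

(** For [g n = chebC n x q r / (1 - q ^ (n + 2))], the equation at [s ^ n] has
    the coefficient [1 - q ^ (n + 2)] at [g n], [2 * x * (1 - q ^ (n + 1))] at
    [g (n - 1)] and [/ r - q ^ n] at [g (n - 2)]: cancelling denominators leaves
    the recurrence of the Chebyshev polynomials. *)
Lemma chebC_qdiff_coeffs (q r x x1 x2 a1 a2 : C) :
  (Cmod q < 1)%R ->
  x1 + x2 = 2 * x -> x1 * x2 = 1 -> a1 + a2 = 2 * x -> a1 * a2 = / r ->
  qdiff_coeffs q (q ^ 2) a1 a2 x1 x2
    (fun n : nat => chebC n x q r / (1 - q ^ (n + 2))).
Proof.
intros Hq Sx Px Sa Pa.
assert (N : forall n, 1 - q ^ S n <> 0)
  by (intros n; apply one_minus_pow_neq_0; [exact Hq|lia]).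
unfold qdiff_coeffs; rewrite Sx, Px, Sa, Pa; repeat split.
- assert (N1 := N 1%nat); simpl in N1 |- *; field; nonzero_up_to_ring.
- assert (N1 := N 1%nat); assert (N2 := N 2%nat); simpl in N1, N2 |- *.
  field; split; nonzero_up_to_ring.
- intros n.
  replace (S (S n) + 2)%nat with (S (S (S (S n)))) by lia.
  replace (S n + 2)%nat with (S (S (S n))) by lia.
  replace (n + 2)%nat with (S (S n)) by lia.
  assert (N1 := N (S n)); assert (N2 := N (S (S n)));
    assert (N3 := N (S (S (S n)))).
  rewrite chebC_SS.
  generalize (chebC (S n) x q r), (chebC n x q r); intros c1 c0.
  generalize (/ r); intros ri.
  simpl in N1, N2, N3 |- *; set (Q := q ^ n) in *; clearbody Q.
  field; repeat split; nonzero_up_to_ring.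
Qed.

(** In the equation at [s ^ n], the coefficient [1 - r * q ^ (n + 1)] of the
    leading term removes the last factor of [qpoch (q * r) q (n + 1)], and the
    other two coefficients both carry [1 - q ^ (n + 1)], the last factor of
    [qpoch (q ^ 2) q n]. *)
Lemma chebCt_qdiff_coeffs (q r x x1 x2 at1 at2 rh : C) :
  r <> 0 -> (Cmod q < 1)%R -> (Cmod (q * r) < 1)%R -> rh ^ 2 = r ->
  x1 + x2 = 2 * x -> x1 * x2 = 1 ->
  at1 + at2 = 2 * x / r -> at1 * at2 = / r ->
  qdiff_coeffs q (q * r) x1 x2 (q * at1) (q * at2)
    (fun n : nat => qpoch (q ^ 2) q n / qpoch (q * r) q (n + 1)
                    * chebCt n x q r rh).
Proof.
intros Hr Hq Hqr Hrh Sx Px Sa Pa.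
assert (Sqa : q * at1 + q * at2 = 2 * q * x / r).
{ transitivity (q * (at1 + at2)); [ring|rewrite Sa; field; exact Hr]. }
assert (Pqa : q * at1 * (q * at2) = q ^ 2 / r).
{ transitivity (q ^ 2 * (at1 * at2)); [ring|rewrite Pa; field; exact Hr]. }
assert (N : forall n, 1 - q ^ S n <> 0)
  by (intros n; apply one_minus_pow_neq_0; [exact Hq|lia]).
assert (D : forall n, 1 - q * r * q ^ n <> 0).
{ intros n; apply one_minus_neq_0.
  apply Rle_lt_trans with (2 := Hqr); now apply Cmod_mult_pow_le. }
unfold qdiff_coeffs; rewrite Sx, Px, Sqa, Pqa; repeat split.
- assert (D0 := D 0%nat); unfold chebCt; simpl in D0 |- *; field.
  nonzero_up_to_ring.
- assert (Hrh0 : rh <> 0) by (intros E; apply Hr; rewrite <- Hrh, E; ring).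
  assert (D0 := D 0%nat); assert (D1 := D 1%nat).
  unfold chebCt; simpl in D0, D1 |- *; field.
  repeat split; nonzero_up_to_ring.
- intros n.
  replace (S (S n) + 1)%nat with (S (S (S n))) by lia.
  replace (S n + 1)%nat with (S (S n)) by lia.
  replace (n + 1)%nat with (S n) by lia.
  assert (N1 := N n); assert (N2 := N (S n)).
  assert (D1 := D n); assert (D2 := D (S n)); assert (D3 := D (S (S n))).
  assert (P : qpoch (q * r) q n <> 0) by now apply qpoch_neq_0.
  rewrite chebCt_SS by assumption.
  generalize (chebCt (S n) x q r rh), (chebCt n x q r rh); intros c1 c0.
  revert P; simpl in N1, N2, D1, D2, D3 |- *.
  generalize (qpoch (q * r) q n), (qpoch (q * (q * 1)) q n); intros b a P.
  set (Q := q ^ n) in *; clearbody Q.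
  field; repeat split; nonzero_up_to_ring.
Qed.

Theorem proposition4p8 :
  forall q r x : C,
    r <> 0 -> (0 < Cmod q < 1)%R ->
    (forall u v x1 x2 a1 a2 : C,
       u ^ 2 = x ^ 2 - 1 -> x1 = x + u -> x2 = x - u ->
       v ^ 2 = x ^ 2 - / r -> a1 = x + v -> a2 = x - v ->
       locally (0 : C) (fun s : C =>
         exists phi : C,
           is_phi32 q (x1 * s) (x2 * s) (q * a1 * s) (q * a2 * s) q (q ^ 2) phi /\
           is_pseries (fun n : nat => chebC n x q r / (1 - q ^ (n + 2))) s
             (1 / (1 - 2 * x * s + / r * s ^ 2) * phi)))
    /\
    ((Cmod (q * r) < 1)%R ->
     forall u w x1 x2 at1 at2 rh : C,
       u ^ 2 = x ^ 2 - 1 -> x1 = x + u -> x2 = x - u ->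
       w ^ 2 = x ^ 2 - r -> at1 = / r * (x + w) -> at2 = / r * (x - w) ->
       rh ^ 2 = r ->
       locally (0 : C) (fun s : C =>
         exists phi : C,
           is_phi32 q (q * at1 * s) (q * at2 * s) (q * x1 * s) (q * x2 * s)
             q (q * r) phi /\
           is_pseries
             (fun n : nat => qpoch (q ^ 2) q n / qpoch (q * r) q (n + 1)
                             * chebCt n x q r rh) s
             (1 / (1 - 2 * x * s + s ^ 2) * phi) /\
           is_pseries
             (fun n : nat => qpoch (q ^ 2) q n / qpoch (q * r) q (n + 1)
                             * chebC n (/ rh * x) q r) (rh * s)
             (1 / (1 - 2 * x * s + s ^ 2) * phi))).
Proof.
intros q r x Hr [_ Hq]; split.
- intros u v x1 x2 a1 a2 Hu Hx1 Hx2 Hv Ha1 Ha2.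
  assert (Sx : x1 + x2 = 2 * x) by (rewrite Hx1, Hx2; ring).
  assert (Px : x1 * x2 = 1).
  { transitivity (x ^ 2 - u ^ 2); [rewrite Hx1, Hx2|rewrite Hu]; ring. }
  assert (Sa : a1 + a2 = 2 * x) by (rewrite Ha1, Ha2; ring).
  assert (Pa : a1 * a2 = / r).
  { transitivity (x ^ 2 - v ^ 2); [rewrite Ha1, Ha2|rewrite Hv]; ring. }
  assert (Hq2 : (Cmod (q ^ 2) < 1)%R).
  { rewrite Cmod_pow; assert (H := Cmod_ge_0 q); simpl; nra. }
  generalize (qdiff_solution_is_phi32 _ _ _ _ _ _ _ Hq Hq2
                (chebC_qdiff_coeffs q r x x1 x2 a1 a2 Hq Sx Px Sa Pa)).
  apply filter_imp; intros s (phi & H1 & H2); exists phi; split; [exact H1|].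
  replace (1 - 2 * x * s + / r * s ^ 2) with ((1 - a1 * s) * (1 - a2 * s));
    [exact H2|].
  rewrite <- Sa, <- Pa; ring.
- intros Hqr u w x1 x2 at1 at2 rh Hu Hx1 Hx2 Hw Hat1 Hat2 Hrh.
  assert (Sx : x1 + x2 = 2 * x) by (rewrite Hx1, Hx2; ring).
  assert (Px : x1 * x2 = 1).
  { transitivity (x ^ 2 - u ^ 2); [rewrite Hx1, Hx2|rewrite Hu]; ring. }
  assert (Sa : at1 + at2 = 2 * x / r)
    by (rewrite Hat1, Hat2; field; exact Hr).
  assert (Pa : at1 * at2 = / r).
  { transitivity (/ r ^ 2 * (x ^ 2 - w ^ 2));
      [rewrite Hat1, Hat2|rewrite Hw]; field; exact Hr. }
  generalize (qdiff_solution_is_phi32 _ _ _ _ _ _ _ Hq Hqr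
    (chebCt_qdiff_coeffs q r x x1 x2 at1 at2 rh Hr Hq Hqr Hrh Sx Px Sa Pa)).
  apply filter_imp; intros s (phi & H1 & H2).
  exists phi; split; [exact H1|].
  replace (1 - 2 * x * s + s ^ 2) with ((1 - x1 * s) * (1 - x2 * s))
    by (rewrite <- Sx; transitivity (1 - (x1 + x2) * s + x1 * x2 * s ^ 2);
        [ring|rewrite Px; ring]).
  split; [exact H2|].
  revert H2; apply is_series_ext; intros n.
  set (p := qpoch (q ^ 2) q n / qpoch (q * r) q (n + 1)).
  set (c := chebC n (/ rh * x) q r).
  change (@pow_n C_AbsRing s n * (p * (rh ^ n * c))
          = @pow_n C_AbsRing (rh * s) n * (p * c)).
  rewrite !pow_n_C, Cpow_mult_l.
  generalize (s ^ n), (rh ^ n); intros; ring.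
Qed.
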